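(* Let $X$ be a connected compact metric space and let $f:X\to X$ be continuous such that the dynamical system $(X,f)$ has shadowing. Then $(X,f)$ is minimal if and only if it is recurrent.
   Context: A dynamical system is a pair $(X,f)$ with $(X,d)$ a compact metric space and $f:X\to X$ continuous; $\omega$ denotes the non-negative integers. For $\delta>0$, a $\delta$-pseudo-orbit for $f$ is a sequence $\langle x_i\rangle_{i\in\omega}$ in $X$ with $d(f(x_i),x_{i+1})<\delta$ for all $i\in\omega$. $(X,f)$ has shadowing if for every $\epsilon>0$ there is $\delta>0$ such that for every $\delta$-pseudo-orbit $\langle x_i\rangle$ for $f$ there is $z\in X$ with $d(x_i,f^i(z))<\epsilon$ for all $i\in\omega$. A point $x\in X$ is recurrent if for every $\epsilon>0$ there is $n>0$ with $d(f^n(x),x)<\epsilon$; $(X,f)$ is recurrent if every point of $X$ is recurrent. $(X,f)$ is minimal if every nonempty closed $A\subseteq X$ with $f(A)\subseteq A$ equals $X$. *)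

(* Defs.v *)
From HB Require Import structures.
From mathcomp Require Import all_boot all_order all_algebra.
From mathcomp Require Import boolp classical_sets reals topology.

Set Implicit Arguments.
Unset Strict Implicit.
Unset Printing Implicit Defensive.

Local Open Scope classical_set_scope.
Local Open Scope ring_scope.

Definition pseudo_orbit (R : realType) (X : metricType R) (f : X -> X)
    (delta : R) (x : nat -> X) : Prop :=
  forall i : nat, mdist (f (x i)) (x i.+1) < delta.

Definition shadowing (R : realType) (X : metricType R) (f : X -> X) : Prop :=
  forall eps : R, 0 < eps ->
    exists2 delta : R, 0 < delta &
      forall x : nat -> X, pseudo_orbit f delta x ->
        exists z : X, forall i : nat, mdist (x i) (iter i f z) < eps.

Definition recurrent_point (R : realType) (X : metricType R) (f : X -> X)
    (x : X) : Prop :=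
  forall eps : R, 0 < eps ->
    exists2 n : nat, (0 < n)%N & mdist (iter n f x) x < eps.

Definition recurrent (R : realType) (X : metricType R) (f : X -> X) : Prop :=
  forall x : X, recurrent_point f x.

Definition minimal (X : topologicalType) (f : X -> X) : Prop :=
  forall A : set X, A !=set0 -> closed A -> f @` A `<=` A -> A = [set: X].

(* Main.v *)
Require Import Defs.
From mathcomp Require Import all_boot all_order all_algebra.
From mathcomp Require Import boolp classical_sets reals topology.
From mathcomp Require Import lra.

(** The closure of a forward orbit [f x, f (f x), ...] is a nonempty closed
    forward-invariant set, so minimality forces it to be the whole space; it
    then contains [x], which is recurrence.

    For the converse, recurrence first makes [f] chain transitive. Let
    [chain_reachable f delta y] be the set of points that a [delta]-chain
    starting at [y] leads to. If [s] is reachable and [w] is within [delta / 2]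
    of [s], then following the orbit of [s] until it comes back within
    [delta / 2] of [s] and jumping to [w] instead shows that [w] is reachable
    ([chain_reachable_near]). Hence the reachable set contains the
    [delta / 2]-neighbourhood of each of its points, which makes it both open
    and closed; as [X] is connected, every point is reachable from every other.

    Now let [A] be nonempty, closed and forward-invariant, let [y] be any point
    and let [a] be in [A]. Take a pseudo-orbit that goes from [y] to [a] and
    from there follows the true orbit of [a], thus staying in [A] from some
    time [n] on. A shadowing point [z] is close to [y], and its orbit is close
    to [A] after time [n]. Since [z] is recurrent, its orbit comes back close
    to [z] at a time past [n] ([recurrent_point_late]), so [z], and therefore
    [y], is close to [A]. As [A] is closed, [y] lies in [A]. *)

Set Implicit Arguments.
Unset Strict Implicit.
Unset Printing Implicit Defensive.

Import Order.TTheory GRing.Theory Num.Theory.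

Local Open Scope classical_set_scope.
Local Open Scope ring_scope.

Lemma closure_mdistP (R : realType) (X : metricType R) (A : set X) (p : X) :
  closure A p <->
  forall e : R, 0 < e -> exists2 a, A a & mdist p a < e.
Proof.
split=> [clAp e e0|nearA B /nbhs_ballP[e /= e0 eB]].
  have [a [Aa]] := clAp _ (nbhsx_ballx p e e0).
  by rewrite ballEmdist /=; exists a.
have [a Aa pa] := nearA e e0.
by exists a; split=> //; apply: eB; rewrite ballEmdist.
Qed.

Lemma continuous_mdist (R : realType) (X : metricType R) (f : X -> X) (x : X)
    (e : R) : {for x, continuous f} -> 0 < e ->
  exists2 d : R, 0 < d & forall w, mdist x w < d -> mdist (f x) (f w) < e.
Proof.
move=> /metricType_numDomainType.cvgrPdist_lt/[apply].
move=> /metricType_numDomainType.nbhs_mdistP[d d0 fd].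
by exists d.
Qed.

Lemma continuous_iter (T : topologicalType) (f : T -> T) (n : nat) :
  continuous f -> continuous (iter n f).
Proof.
move=> cf; elim: n => [|n IHn] x; first exact: cvg_id.
exact: (continuous_comp (IHn x) (cf _)).
Qed.

Lemma minimal_recurrent (R : realType) (X : metricType R) (f : X -> X) :
  continuous f -> minimal f -> recurrent f.
Proof.
move=> cf minf x e e0.
pose orb := closure (range (fun n => iter n.+1 f x)).
have orbT : orb = [set: X].
  apply: minf; last first.
  - move=> _ [p /closure_mdistP orbp <-]; apply/closure_mdistP => r r0.
    have [d d0 fd] := continuous_mdist (cf p) r0.
    have [_ [n _ <-] pn] := orbp d d0.
    by exists (iter n.+2 f x); [exists n.+1 | exact: fd].
  - exact: closed_closure.
  - by exists (f x); apply: subset_closure; exists 0%N.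
have /closure_mdistP /(_ e e0) [_ [n _ <-] xn] : orb x by rewrite orbT.
by exists n.+1 => //; rewrite metric_sym.
Qed.

(** Returning once very close to [x] keeps the next return close to [x] as
    well, by continuity of the iterate already used; so return times
    accumulate. *)
Lemma recurrent_point_late (R : realType) (X : metricType R) (f : X -> X)
    (x : X) (k : nat) (e : R) :
  continuous f -> recurrent_point f x -> 0 < e ->
  exists2 n : nat, (k <= n)%N & mdist (iter n f x) x < e.
Proof.
move=> cf recx e0; elim: k => [|k [n kn nx]].
  by exists 0%N; rewrite //= mdistxx.
have slack : 0 < e - mdist (iter n f x) x by rewrite subr_gt0.
have [d d0 fd] := continuous_mdist (continuous_iter (n := n) cf (x := x)) slack.
have [m m0 mx] := recx d d0.
exists (n + m)%N; first by rewrite -addn1 leq_add.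
have := fd (iter m f x); rewrite metric_sym => /(_ mx).
have := metric_triangle (iter (n + m) f x) (iter n f x) x.
rewrite iterD (metric_sym _ (iter n f x)); lra.
Qed.

(** A finite [delta]-chain from [y] to [w] is encoded as an infinite
    pseudo-orbit that arrives at [w] at time [n] and then follows its true
    orbit, the form in which shadowing can be applied to it. *)
Definition chain_reachable (R : realType) (X : metricType R) (f : X -> X)
    (delta : R) (y : X) : set X :=
  [set w | exists (u : nat -> X) (n : nat),
    [/\ pseudo_orbit f delta u, u 0%N = y & forall i, u (n + i)%N = iter i f w]].

Lemma chain_reachable_refl (R : realType) (X : metricType R) (f : X -> X)
    (delta : R) (y : X) : 0 < delta -> chain_reachable f delta y y.
Proof.
move=> d0; exists (fun i => iter i f y), 0%N; split=> // i.
by rewrite /= mdistxx.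
Qed.

Lemma chain_reachable_step (R : realType) (X : metricType R) (f : X -> X)
    (delta : R) (y w w' : X) : 0 < delta ->
  chain_reachable f delta y w -> mdist (f w) w' < delta ->
  chain_reachable f delta y w'.
Proof.
move=> d0 [u [n [pu u0 un]]] ww'.
exists (fun i => if (i <= n)%N then u i else iter (i - n.+1) f w'), n.+1.
split=> // [i|i]; last by rewrite leqNgt ltnS leq_addr /= addKn.
have [iltn|nlti|->] := ltngtP i n.
- exact: pu.
- by rewrite subSn //= mdistxx.
- by rewrite subnn -(addn0 n) un.
Qed.

Lemma chain_reachable_iter (R : realType) (X : metricType R) (f : X -> X)
    (delta : R) (y w : X) (n : nat) : 0 < delta ->
  chain_reachable f delta y w -> chain_reachable f delta y (iter n f w).
Proof.
move=> d0 yw; elim: n => //= n IHn.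
by apply: chain_reachable_step IHn _ => //; rewrite mdistxx.
Qed.

(** Wait for the orbit of [s] to return near [s]; since the return time is
    positive, its last step can be replaced by a jump to [w]. *)
Lemma chain_reachable_near (R : realType) (X : metricType R) (f : X -> X)
    (delta : R) (y s w : X) : 0 < delta -> recurrent_point f s ->
  chain_reachable f delta y s -> mdist s w < delta / 2 ->
  chain_reachable f delta y w.
Proof.
move=> d0 recs ys sw.
have [[|n] // _ ns] := recs (delta / 2) ltac:(lra).
apply: chain_reachable_step (chain_reachable_iter n d0 ys) _ => //.
have := metric_triangle (iter n.+1 f s) s w; rewrite /= in ns *; lra.
Qed.

Lemma recurrent_chain_transitive (R : realType) (X : metricType R) (f : X -> X)
    (delta : R) (y : X) : connected [set: X] -> recurrent f -> 0 < delta ->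
  chain_reachable f delta y = [set: X].
Proof.
move=> connX recf d0; have d20 : 0 < delta / 2 by lra.
apply: connX.
- by exists y; exact: chain_reachable_refl.
- exists (chain_reachable f delta y); last by rewrite setTI.
  rewrite openE => s ys; apply/nbhs_ballP; exists (delta / 2) => // w.
  by rewrite ballEmdist /=; exact: chain_reachable_near.
- exists (chain_reachable f delta y); last by rewrite setTI.
  move=> w /closure_mdistP/(_ _ d20)[s ys].
  by rewrite metric_sym; exact: chain_reachable_near.
Qed.

Lemma recurrent_minimal (R : realType) (X : metricType R) (f : X -> X) :
  connected [set: X] -> continuous f -> shadowing f ->
  recurrent f -> minimal f.
Proof.
move=> connX cf shf recf A [a Aa] clA fA; apply/seteqP; split=> // y _.
have Aorb i : A (iter i f a).
  by elim: i => //= i Ai; apply: fA; exists (iter i f a).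
apply: clA; apply/closure_mdistP => e e0.
(* one third each for y to z, z to its late return, and that return to A *)
have e30 : 0 < e / 3 by lra.
have [delta d0 sh] := shf _ e30.
have : chain_reachable f delta y a by rewrite recurrent_chain_transitive.
move=> [u [n [/sh[z uz] u0 un]]].
have [m nm mz] := recurrent_point_late n cf (recf z) e30.
exists (iter (m - n) f a) => //.
have yz := uz 0%N; have am := uz m; rewrite u0 /= in yz.
rewrite -{1}(subnKC nm) un in am.
have := metric_triangle y z (iter (m - n) f a).
have := metric_triangle z (iter m f z) (iter (m - n) f a).
rewrite (metric_sym z (iter m f z)) (metric_sym (iter m f z) (iter _ f a)); lra.
Qed.

Theorem corollary10 (R : realType) (X : metricType R) (f : X -> X)
  (X_compact : compact [set: X]) (X_connected : connected [set: X])
  (f_continuous : continuous f) (f_shadowing : shadowing f) :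
  minimal f <-> recurrent f.
Proof.
split; first exact: minimal_recurrent.
exact: recurrent_minimal.
Qed.
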